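(* Let $(\varphi_n)_{n\ge 1}$ be an orthonormal system on $[0,1]$ and let $d=(d_n)_{n\ge1}$ be a given sequence of numbers. If for any $a=(a_n)\in \ell_2$ $$G_n(d,a)=O(1)\,T_n(d,a),$$ then for every $f\in V(0,1)$ $$\sum_{n=1}^{\infty} d_n^2\, C_n^2(f)\,\log^2 n<\infty .$$
   Context: An orthonormal system (ONS) on $[0,1]$ is a sequence of functions orthonormal in $L_2(0,1)$. $\log$ denotes $\log_2$. $V(0,1)$ is the class of all functions of bounded variation on $[0,1]$. For $f\in L_2(0,1)$ the Fourier coefficients are $C_n(f)=\int_0^1 f(x)\varphi_n(x)\,dx$, $n=1,2,\dots$. For $a=(a_n)\in\ell_2$ put $$P_n(d,a,x)=\sum_{k=1}^n d_k^2\,a_k\,\log^2 k\;\varphi_k(x),$$ $$G_n(d,a)=\max_{1\le i\le n}\left|\int_0^{i/n}P_n(d,a,x)\,dx\right|,\qquad T_n(d,a)=\left(\sum_{k=1}^n d_k^2a_k^2\log^2 k\right)^{1/2}.$$ The $O(1)$ refers to $n\to\infty$. *)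

(* Defs.v *)
From HB Require Import structures.
From mathcomp Require Import all_boot all_order all_algebra.
From mathcomp Require Import all_classical all_reals all_analysis.

Set Implicit Arguments.
Unset Strict Implicit.
Unset Printing Implicit Defensive.

Import Order.TTheory GRing.Theory Num.Theory.
Import numFieldNormedType.Exports.

Local Open Scope classical_set_scope.
Local Open Scope ring_scope.

(* Functions on [0, 1] are total functions R -> R of which only the restriction
   to [0, 1] is used.  Sequences indexed by n = 1, 2, ... are functions on nat
   whose value at 0 is never used. *)

Definition log2 (R : realType) (x : R) : R := ln x / ln 2.

Definition integral01 (R : realType) (f : R -> R) : R :=
  Rintegral (@lebesgue_measure R) `[0, 1] f.

Definition L2_01 (R : realType) (f : R -> R) : Prop :=
  measurable_fun (`[0, 1] : set R) f /\
  (@lebesgue_measure R).-integrable `[0, 1] (fun x => (f x ^+ 2)%:E).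

Definition orthonormal_system (R : realType) (phi : nat -> R -> R) : Prop :=
  (forall n, (0 < n)%N -> L2_01 (phi n)) /\
  (forall m n, (0 < m)%N -> (0 < n)%N ->
     integral01 (fun x => phi m x * phi n x) = (m == n)%:R).

Definition ell2 (R : realType) (a : nat -> R) : Prop :=
  (\sum_(1 <= n <oo) (a n ^+ 2)%:E < +oo)%E.

Definition fourier_coef (R : realType) (phi : nat -> R -> R) (f : R -> R)
    (n : nat) : R :=
  integral01 (fun x => f x * phi n x).

Definition P_ (R : realType) (phi : nat -> R -> R) (d a : nat -> R)
    (n : nat) (x : R) : R :=
  \sum_(1 <= k < n.+1) d k ^+ 2 * a k * log2 k%:R ^+ 2 * phi k x.

(* The maximand is nonnegative, so the default value 0 of the big maximum does
   not affect it when n >= 1. *)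
Definition G_ (R : realType) (phi : nat -> R -> R) (d a : nat -> R)
    (n : nat) : R :=
  \big[Num.max/0]_(1 <= i < n.+1)
    `|Rintegral (@lebesgue_measure R) `[0, i%:R / n%:R] (P_ phi d a n)|.

Definition T_ (R : realType) (d a : nat -> R) (n : nat) : R :=
  Num.sqrt (\sum_(1 <= k < n.+1) d k ^+ 2 * a k ^+ 2 * log2 k%:R ^+ 2).

(* Main.v *)
Require Import Defs.
From HB Require Import structures.
From mathcomp Require Import all_boot all_order all_algebra.
From mathcomp Require Import all_classical all_reals all_analysis.
From mathcomp Require Import measurable_realfun ring lra.

Set Implicit Arguments.
Unset Strict Implicit.
Unset Printing Implicit Defensive.

Import Order.TTheory GRing.Theory Num.Theory.
Import numFieldNormedType.Exports.

Local Open Scope classical_set_scope.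
Local Open Scope ring_scope.

(** Write [w k = d k ^+ 2 * log2 k ^+ 2] and let [C k] be the Fourier
coefficients of [f].  Suppose that the series of terms [s k = w k * C k ^+ 2]
diverges.  The hypothesis on [G_] and [T_] is then contradicted by a single
square-summable sequence [a], equal to [C] on a union of blocks of indices and
to 0 elsewhere; it is square summable by Bessel's inequality ([bessel]).

For such an [a], integrating [f] against the polynomial [P_ phi d a m] gives
[\sum_(k <= m) w k * a k * C k = \sum_(k <= m) w k * a k ^+ 2 = T_ d a m ^+ 2].
Replace [f], in this integral, by its value at the right end of each of the [m]
cells of the uniform grid.

- The resulting sum depends on the polynomial only through its integrals over
  the intervals from 0 to [i / m], so summation by parts bounds it by
  [(`|f 1| + V) * G_ phi d a m], where [V] is the variation of [f]
  ([right_sum_le_G]), hence by a constant times [T_ d a m].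
- For each [phi k], which has norm 1, the replacement costs at most
  [V / sqrt m] ([right_sum_error]), so that it costs at most
  [V / sqrt m * \sum_(k <= m) `|w k * a k|] for the polynomial.

Since [d] is arbitrary, the last quantity need not be small when [a = C].  This
is where the gaps between the blocks come in ([sparse_blocks]): if [a] vanishes
between [p] and [m], then only the indices up to [p] contribute, and a choice
of [m] large with respect to [p] makes the cost at most 1.  For such [m],
[T_ ^+ 2 <= B * K * T_ + 1] with fixed [B] and [K], so [T_ d a m] is bounded.
But each block is chosen to carry at least 1 of the divergent series, so that
[T_ d a m] is unbounded along these [m]. *)

(** * Sums and series *)

Lemma nneseries_lty (R : realType) (u : nat -> R) (M : R) :
  (forall n, 0 <= u n) -> (forall n, \sum_(1 <= k < n.+1) u k <= M) ->
  (\sum_(1 <= n <oo) (u n)%:E < +oo)%E.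
Proof.
move=> u0 uM; apply: (@le_lt_trans _ _ M%:E); last exact: ltry.
apply: lime_le.
  by apply: is_cvg_nneseries => n _ _; rewrite lee_fin.
apply: nearW => -[|n].
  by rewrite big_geq// lee_fin; have := uM 0%N; rewrite big_geq.
by rewrite sumEFin lee_fin.
Qed.

(** Summation by parts moves the differences from [F] to [u]; as [F] vanishes at
0, the only boundary term is [u n * F n]. *)
Lemma abel_summation_bound (R : realType) (u F : nat -> R) (G : R) (n : nat) :
  F 0%N = 0 -> (forall i, (i <= n)%N -> `|F i| <= G) ->
  `|\sum_(0 <= i < n) u i.+1 * (F i.+1 - F i)| <=
  (`|u n| + \sum_(0 <= i < n) `|u i.+1 - u i|) * G.
Proof.
move=> F0 FG.
have -> : \sum_(0 <= i < n) u i.+1 * (F i.+1 - F i) =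
    u n * F n - \sum_(0 <= i < n) (u i.+1 - u i) * F i.
  elim: n {FG} => [|n IH]; first by rewrite !big_geq// F0; ring.
  by rewrite !big_nat_recr//= IH; ring.
rewrite (le_trans (ler_normB _ _))// mulrDl lerD//.
  by rewrite normrM ler_wpM2l// FG.
rewrite (le_trans (ler_norm_sum _ _ _))// mulr_suml.
rewrite big_nat [leRHS]big_nat; apply: ler_sum => i /andP[_ ilt].
by rewrite normrM ler_wpM2l// FG// ltnW.
Qed.

(** The set [A] is a union of blocks, each carrying at least 1 of the divergent
series of terms [s]; the next block starts only beyond [h p], where [p] is the
end of the current one.  The function [h] thus prescribes how long the gap after
an index must be. *)
Lemma sparse_blocks (R : realType) (s : nat -> R) (h : nat -> nat) :
  (forall k, 0 <= s k) ->
  (forall M, exists n, M < \sum_(1 <= k < n.+1) s k) ->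
  exists A : pred nat, forall N : nat, exists p m : nat,
    [/\ (N <= m)%N, (p <= m)%N, (h p <= m)%N,
      forall k, (p < k)%N -> (k <= m)%N -> ~~ A k &
      N%:R <= \sum_(1 <= k < m.+1 | A k) s k].
Proof.
move=> s0 sinf.
have block n : exists p, (n < p)%N /\ 1 <= \sum_(n.+1 <= k < p.+1) s k.
  have [p hp] := sinf (\sum_(1 <= k < n.+1) s k + 1).
  have np : (n < p)%N.
    rewrite ltnNge; apply/negP => pn; move: hp; apply/negP; rewrite -leNgt.
    rewrite (@big_cat_nat _ _ _ p.+1 1 n.+1)//= -addrA lerDl addr_ge0//.
    exact: sumr_ge0.
  exists p; split => //; move: hp.
  by rewrite (@big_cat_nat _ _ _ n.+1 1 p.+1)//= ?ltnS 1?ltnW// ltrD2l => /ltW.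
have [q hq] := choice block.
(* The block after index [n] is the set of the indices [k] with [n < k <= q n],
   and the following one comes after index [next n]. *)
pose next n := (maxn (q n) (h (q n))).+1.
pose st j := iter j next 0%N.
have stS j : st j.+1 = next (st j) by [].
have q_next n : (q n < next n)%N by rewrite ltnS leq_maxl.
have st_next j : (st j < st j.+1)%N.
  by rewrite stS (ltn_trans _ (q_next _))//; case: (hq (st j)).
have st_mono i j : (i <= j)%N -> (st i <= st j)%N.
  apply: (@homo_leq _ st leq leqnn) => [? ? ?|k]; first exact: leq_trans.
  exact: ltnW.
pose A k := `[< exists j, (st j < k <= q (st j))%N >].
have st_ge j : (j <= st j)%N.
  by elim: j => // j IH; exact: leq_ltn_trans IH (st_next j).
have st_sum j : j%:R <= \sum_(1 <= k < (st j).+1 | A k) s k.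
  elim: j => [|j IH]; first by rewrite big_geq.
  have [h1 h2] := hq (st j).
  have qn := q_next (st j); rewrite -stS in qn.
  rewrite (@big_cat_nat _ _ _ (st j).+1 1)//=; last by rewrite ltnS ltnW// st_next.
  rewrite (@big_cat_nat _ _ _ (q (st j)).+1 (st j).+1)//= ?ltnS; [|exact: ltnW..].
  rewrite -natr1 lerD// -[leLHS]addr0 lerD ?sumr_ge0//.
  rewrite (le_trans h2)// le_eqVlt; apply/orP; left; apply/eqP.
  rewrite big_nat [RHS]big_nat_cond; apply: eq_bigl => k.
  rewrite ltnS; case: andP => //= -[h3 h4]; apply/esym/asboolP.
  by exists j; rewrite h3.
exists A => N; exists (q (st N)), (st N.+1).
have qm : (q (st N) < st N.+1)%N by rewrite stS.
split.
- exact: leq_trans (st_ge N) (ltnW (st_next N)).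
- exact: ltnW.
- by rewrite stS leqW// leq_maxr.
- move=> k qk km; apply/asboolP => -[i /andP[ik kq]].
  have [iN|Ni] := leqP i N; last first.
    by move: (leq_trans ik km); rewrite ltnNge st_mono.
  move: iN; rewrite leq_eqVlt => /predU1P[iN|iN].
    by move: (leq_trans qk kq); rewrite iN ltnn.
  have := leq_ltn_trans kq (q_next (st i)); rewrite -stS => kst.
  have := leq_trans kst (st_mono _ _ iN).
  rewrite ltnNge => /negP; apply.
  by rewrite (leq_trans _ (ltnW qk))// ltnW//; case: (hq (st N)).
- by rewrite (le_trans _ (st_sum N.+1))// ler_nat.
Qed.

(** * Square-integrable functions and Bessel's inequality *)

Lemma integrable_scale (R : realType) (D : set R) (f : R -> R) (c : R) :
  measurable D -> (@lebesgue_measure R).-integrable D (EFin \o f) ->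
  (@lebesgue_measure R).-integrable D (EFin \o (fun x => c * f x)).
Proof.
move=> mD fi.
have -> : EFin \o (fun x => c * f x) = (fun x => c%:E * (EFin \o f) x)%E.
  by apply/funext => x /=; rewrite EFinM.
exact: integrableZl.
Qed.

Lemma Rintegral_sum d (T : measurableType d) (R : realType)
    (mu : {measure set T -> \bar R}) (D : set T) (I : Type) (s : seq I)
    (g : I -> T -> R) : measurable D ->
  (forall i, mu.-integrable D (EFin \o g i)) ->
  Rintegral mu D (fun x => \sum_(i <- s) g i x) =
  \sum_(i <- s) Rintegral mu D (g i).
Proof.
move=> mD ig; elim: s => [|i s IH].
  under eq_Rintegral do rewrite big_nil.
  by rewrite big_nil Rintegral_cst// mul0r.
under eq_Rintegral do rewrite big_cons.
rewrite RintegralD//; first by rewrite big_cons IH.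
have -> : EFin \o (fun x => \sum_(i <- s) g i x) =
    (fun x => \sum_(i <- s) (EFin \o g i) x)%E.
  by apply/funext => x /=; rewrite sumEFin.
exact: integrable_sum.
Qed.

Lemma L2_01_integrable_mul (R : realType) (f g : R -> R) :
  L2_01 f -> L2_01 g ->
  (@lebesgue_measure R).-integrable `[0, 1] (EFin \o (fun x => f x * g x)).
Proof.
move=> [mf f2] [mg g2].
apply: le_integrable (integrableD _ f2 g2) => //.
  by apply/measurable_EFinP; exact: measurable_funM.
move=> x _ /=; rewrite lee_fin normrM [leRHS]ger0_norm ?addr_ge0 ?sqr_ge0//.
rewrite -(real_normK (num_real (f x))) -(real_normK (num_real (g x))).
have := sqr_ge0 (`|f x| - `|g x|); have := sqr_ge0 `|f x|.
have := sqr_ge0 `|g x|; nra.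
Qed.

Lemma L2_01_bounded (R : realType) (f : R -> R) (M : R) :
  measurable_fun (`[0, 1] : set R) f ->
  (forall x, 0 <= x <= 1 -> `|f x| <= M) -> L2_01 f.
Proof.
move=> mf fM; split => //.
apply: measurable_bounded_integrable => //.
- by rewrite /= lebesgue_measure_itv/= lte_fin ltr01 oppr0 adde0 ltry.
- exact: measurable_funX.
- exists (M ^+ 2); split; first exact: num_real.
  move=> r Mr x /=; rewrite in_itv/= => x01.
  rewrite normrX (le_trans _ (ltW Mr))// lerXn2r ?nnegrE ?fM//.
  by rewrite (le_trans _ (fM _ x01)).
Qed.

Lemma L2_01_cst (R : realType) (c : R) : L2_01 (cst c).
Proof. by apply: (@L2_01_bounded _ _ `|c|). Qed.

Lemma L2_01_integrable (R : realType) (f : R -> R) : L2_01 f ->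
  (@lebesgue_measure R).-integrable `[0, 1] (EFin \o f).
Proof.
move=> f2; have := L2_01_integrable_mul f2 (L2_01_cst 1).
by congr (integrable _ _); apply/funext => x /=; rewrite mulr1.
Qed.

Lemma L2_01_subZ (R : realType) (f g : R -> R) (c : R) :
  L2_01 f -> L2_01 g -> L2_01 (fun x => f x - c * g x).
Proof.
move=> f2 g2; have [mf if2] := f2; have [mg ig2] := g2.
have mfg : measurable_fun (`[0, 1] : set R) (fun x => f x - c * g x).
  by apply: measurable_funB => //; exact: measurable_funM.
split => //.
have mI : measurable (`[0, 1] : set (measurableTypeR R)) by [].
apply: le_integrable (integrableD mI (integrableZl mI 2 if2)
  (integrableZl mI (2 * c ^+ 2) ig2)) => //.
  by apply/measurable_EFinP; exact: measurable_funX.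
move=> x _ /=; rewrite lee_fin (ger0_norm (sqr_ge0 _)).
rewrite [leRHS]ger0_norm; last first.
  by rewrite addr_ge0// mulr_ge0 ?sqr_ge0// mulr_ge0 ?sqr_ge0.
by have := sqr_ge0 (f x + c * g x); nra.
Qed.

(** The remainder [r] is [f] minus its [n]-th Fourier sum.  Carrying along that
[r] has the same later coefficients as [f] makes each step of the induction
involve a single new function [phi n.+1]. *)
Lemma bessel_remainder (R : realType) (phi : nat -> R -> R) (f : R -> R) :
  orthonormal_system phi -> L2_01 f -> forall n, exists r : R -> R,
  [/\ L2_01 r,
      forall k, (n < k)%N -> fourier_coef phi r k = fourier_coef phi f k &
      integral01 (fun x => r x ^+ 2) = integral01 (fun x => f x ^+ 2) -
        \sum_(1 <= k < n.+1) fourier_coef phi f k ^+ 2].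
Proof.
move=> [phi2 phi_orth] f2; elim=> [|n [r [r2 rphi rsq]]].
  by exists f; split => //; rewrite big_geq// subr0.
set c := fourier_coef phi f n.+1.
have phin := phi2 n.+1 isT.
have mI : measurable (`[0, 1] : set (measurableTypeR R)) by [].
exists (fun x => r x - c * phi n.+1 x); split.
- exact: L2_01_subZ.
- move=> k nk; have phik := phi2 k (leq_ltn_trans (leq0n _) nk).
  rewrite -rphi 1?ltnW// /fourier_coef /integral01.
  under eq_Rintegral do rewrite mulrBl -mulrA.
  rewrite RintegralB ?RintegralZl//; last first.
  + by apply: integrable_scale => //; exact: L2_01_integrable_mul.
  + exact: L2_01_integrable_mul.
  + exact: L2_01_integrable_mul.
  rewrite [X in _ - _ * X](phi_orth n.+1 k)//; last exact: leq_ltn_trans nk.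
  by rewrite ltn_eqF// mulr0 subr0.
- rewrite big_nat_recr//= opprD addrA -rsq /integral01.
  have -> : (fun x => (r x - c * phi n.+1 x) ^+ 2) =
     (fun x => r x * r x - (2 * c * (r x * phi n.+1 x) - c ^+ 2 * (phi n.+1 x * phi n.+1 x))).
    by apply/funext => x; ring.
  have i1 := L2_01_integrable_mul r2 r2.
  have i2 := L2_01_integrable_mul r2 phin.
  have i3 := L2_01_integrable_mul phin phin.
  have i4 := integrable_scale (2 * c) mI i2.
  have i5 := integrable_scale (c ^+ 2) mI i3.
  rewrite RintegralB//; last exact: (integrableB mI i4 i5).
  rewrite RintegralB// !RintegralZl//.
  have -> : Rintegral lebesgue_measure `[0, 1] (fun x => phi n.+1 x * phi n.+1 x) = 1.
    by rewrite [LHS]phi_orth// eqxx.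
  have -> : Rintegral lebesgue_measure `[0, 1] (fun x => r x * phi n.+1 x) = c.
    exact: rphi.
  under [in RHS]eq_Rintegral do rewrite expr2.
  by rewrite -[fourier_coef phi f n.+1]/c; congr (_ - _); ring.
Qed.

Lemma bessel (R : realType) (phi : nat -> R -> R) (f : R -> R) (n : nat) :
  orthonormal_system phi -> L2_01 f ->
  \sum_(1 <= k < n.+1) fourier_coef phi f k ^+ 2 <=
  integral01 (fun x => f x ^+ 2).
Proof.
move=> ons f2; have [r [_ _ rsq]] := bessel_remainder ons f2 n.
rewrite -subr_ge0 -rsq; apply: Rintegral_ge0 => x _; exact: sqr_ge0.
Qed.

(** * Functions of bounded variation *)

(** Bounded variation is used only through such a [v], for instance the total
variation from 0; the variation of [f] on the unit interval is then replaced by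
[v 1 - v 0]. *)
Definition majorizes_variation (R : realType) (v f : R -> R) : Prop :=
  forall x y : R, 0 <= x -> x <= y -> y <= 1 -> `|f y - f x| <= v y - v x.

Lemma bounded_variation_majorant (R : realType) (f : R -> R) :
  bounded_variation 0 1 f -> exists v, majorizes_variation v f.
Proof.
move=> bvf; exists (fun x => fine (total_variation 0 x f)) => x y x0 xy y1.
have fin a b : 0 <= a -> a <= b -> b <= 1 -> total_variation a b f \is a fin_num.
  move=> a0 ab b1; apply/bounded_variationP => //.
  apply: (@bounded_variationr _ 0) => //.
  by apply: bounded_variationl bvf => //; exact: le_trans ab.
rewrite (total_variationD f x0 xy) fineD ?fin// ?(le_trans xy)//.
rewrite [leRHS]addrC addKr -lee_fin fineK ?fin//.
exact: total_variation_ge.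
Qed.

(** Both [v] and [v - f] are nondecreasing on the unit interval. *)
Lemma majorized_measurable (R : realType) (f v : R -> R) :
  majorizes_variation v f ->
  measurable_fun (`[0, 1] : set R) f.
Proof.
move=> fv.
(* Composing with the projection [c] onto the unit interval gives functions
   that are nondecreasing on the whole line. *)
pose c (x : R) := Num.max 0 (Num.min x 1).
have c_nd x y : x <= y -> [/\ 0 <= c x, c x <= c y & c y <= 1].
  move=> xy; rewrite /c.
  case: (leP x 1) => hx; case: (leP y 1) => hy; case: (leP 0 x) => hx0;
    case: (leP 0 y) => hy0; case: (leP 0 (1 : R)) => h1; split; lra.
have mv : measurable_fun (`[0, 1] : set R) (v \o c).
  apply: nondecreasing_measurable => // x y /c_nd[h1 h2 h3] /=.
  by rewrite -subr_ge0 (le_trans _ (fv _ _ h1 h2 h3)).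
have mvf : measurable_fun (`[0, 1] : set R) (fun x => v (c x) - f (c x)).
  apply: nondecreasing_measurable => // x y /c_nd[h1 h2 h3] /=.
  by have := le_trans (ler_norm _) (fv _ _ h1 h2 h3); lra.
apply: eq_measurable_fun (measurable_funB mv mvf) => x.
rewrite inE/= in_itv/= => /andP[x0 x1].
by rewrite /c min_l// max_r//=; ring.
Qed.

Lemma majorized_L2_01 (R : realType) (f v : R -> R) :
  majorizes_variation v f ->
  L2_01 f.
Proof.
move=> fv; apply: (@L2_01_bounded _ _ (`|f 0| + (v 1 - v 0))).
  exact: majorized_measurable fv.
move=> x /andP[x0 x1]; have := fv 0 x (lexx _) x0 x1.
have := le_trans (normr_ge0 _) (fv x 1 x0 x1 (lexx _)).
have := ler_normD (f 0) (f x - f 0); rewrite addrC subrK; lra.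
Qed.

(** * Comparison of an integral with a sum over a uniform grid *)

Lemma integrable_itv_sub01 (R : realType) (g : R -> R) (a b : R) :
  (@lebesgue_measure R).-integrable `[0, 1] (EFin \o g) -> 0 <= a -> b <= 1 ->
  (@lebesgue_measure R).-integrable `[a, b] (EFin \o g).
Proof.
move=> gi a0 b1; apply: integrableS gi => // x /=.
by rewrite !in_itv/= => /andP[ax xb]; rewrite (le_trans a0)// (le_trans xb).
Qed.

Lemma Rintegral_itv_diff (R : realType) (g : R -> R) (a b : R) :
  (@lebesgue_measure R).-integrable `[0, 1] (EFin \o g) ->
  0 <= a -> a <= b -> b <= 1 ->
  Rintegral (@lebesgue_measure R) `[0, b] g -
  Rintegral (@lebesgue_measure R) `[0, a] g =
  Rintegral (@lebesgue_measure R) `[a, b] g.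
Proof.
move=> gi a0 ab b1.
have gi0b := integrable_itv_sub01 gi (lexx _) b1.
rewrite Rintegral_itvB//= Rintegral_itv_obnd_cbnd//.
apply: integrableS (integrable_itv_sub01 gi a0 b1) => // x /=.
by rewrite !in_itv/= => /andP[/ltW -> ->].
Qed.

(** This is the Cauchy-Schwarz inequality against the constant 1.  It follows by
integrating [`|g| <= (s * g ^+ 2 + s^-1) / 2], where the choice
[s = sqrt (b - a)] makes both terms contribute at most [s / 2]. *)
Lemma Rintegral_normr_le_sqrt (R : realType) (g : R -> R) (a b : R) :
  L2_01 g -> integral01 (fun x => g x ^+ 2) <= 1 ->
  0 <= a -> a < b -> b <= 1 ->
  Rintegral (@lebesgue_measure R) `[a, b] (fun x => `|g x|) <=
  Num.sqrt (b - a).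
Proof.
move=> g2 g1 a0 ab b1; set s := Num.sqrt (b - a).
have s0 : 0 < s by rewrite sqrtr_gt0 subr_gt0.
have ss : s * s = b - a by rewrite -expr2 sqr_sqrtr// subr_ge0 ltW.
have mJ : measurable (`[a, b] : set (measurableTypeR R)) by [].
have gi := integrable_itv_sub01 (L2_01_integrable g2) a0 b1.
have g2i := integrable_itv_sub01 (L2_01_integrable_mul g2 g2) a0 b1.
have g2J : Rintegral (@lebesgue_measure R) `[a, b] (fun x => g x * g x) <= 1.
  have i2 := L2_01_integrable_mul g2 g2.
  rewrite -Rintegral_itv_diff// ?(ltW ab)// (le_trans _ g1)//.
  under [leRHS]eq_Rintegral do rewrite expr2.
  rewrite -[leRHS]addr0 lerD//; last first.
    by rewrite oppr_le0 Rintegral_ge0// => x _; rewrite -expr2 sqr_ge0.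
  rewrite -subr_ge0 Rintegral_itv_diff// ?(le_trans a0 (ltW ab))//.
  by apply: Rintegral_ge0 => x _; rewrite -expr2 sqr_ge0.
have ci c : (@lebesgue_measure R).-integrable `[a, b] (EFin \o (fun=> c)).
  exact: (integrable_itv_sub01 (L2_01_integrable (L2_01_cst c)) a0 b1).
have amgm x : `|g x| <= s / 2 * (g x * g x) + s^-1 / 2.
  rewrite -(ler_pM2l s0) mulrDr !mulrA divff ?gt_eqF//.
  rewrite -[X in _ <= X + _](_ : (s * `|g x|) ^+ 2 / 2 = _); last first.
    by rewrite exprMn real_normK ?num_real//; ring.
  by have := sqr_ge0 (s * `|g x| - 1); lra.
have dom : (@lebesgue_measure R).-integrable `[a, b]
    (EFin \o (fun x => s / 2 * (g x * g x))) by exact: integrable_scale.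
apply: (@le_trans _ _ (Rintegral (@lebesgue_measure R) `[a, b]
    (fun x => s / 2 * (g x * g x) + s^-1 / 2))).
  apply: le_Rintegral => //; first exact: integrable_norm.
  exact: (integrableD _ dom (ci _)).
rewrite RintegralD// RintegralZl// Rintegral_cst//.
rewrite /= lebesgue_measure_itv/= lte_fin ab/=.
have -> : s^-1 / 2 * (b - a) = s / 2 by rewrite -ss; field; rewrite gt_eqF.
by nra.
Qed.

(** The integral of [h * g] over the unit interval, for the step function [h]
that is equal on each of the [n] cells of the grid to the value of [f] at the
right end of the cell. *)
Definition right_sum (R : realType) (f g : R -> R) (n : nat) : R :=
  \sum_(0 <= i < n) f (i.+1%:R / n%:R) *
    (Rintegral (@lebesgue_measure R) `[0, i.+1%:R / n%:R] g -
     Rintegral (@lebesgue_measure R) `[0, i%:R / n%:R] g).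

Lemma majorized_grid (R : realType) (f v : R -> R) (n : nat) :
  majorizes_variation v f ->
  (0 < n)%N ->
  \sum_(0 <= i < n) `|f (i.+1%:R / n%:R) - f (i%:R / n%:R)| <= v 1 - v 0.
Proof.
move=> fv n0; have nR : (0 : R) < n%:R by rewrite ltr0n.
apply: (@le_trans _ _ (\sum_(0 <= i < n) (v (i.+1%:R / n%:R) - v (i%:R / n%:R)))).
  rewrite big_nat [leRHS]big_nat; apply: ler_sum => i /andP[_ ilt].
  apply: fv; first by rewrite divr_ge0.
    by rewrite ler_pM2r ?invr_gt0// ler_nat.
  by rewrite ler_pdivrMr// mul1r ler_nat.
by rewrite (telescope_sumr (fun i => v (i%:R / n%:R)))// mul0r divff ?gt_eqF.
Qed.

(** On a cell from [a] to [b], replacing [f] by [f b] costs at most [v b - v a]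
times the integral of [`|g|], which is at most [sqrt (1 / n)]; the increments of
[v] add up to [v 1 - v 0].  The factor [1 / sqrt n] comes from the length of the
cells alone, whence a bound uniform over normalized [g]. *)
Lemma right_sum_error (R : realType) (f v g : R -> R) (n : nat) :
  majorizes_variation v f ->
  L2_01 g -> integral01 (fun x => g x ^+ 2) <= 1 -> (0 < n)%N ->
  `|integral01 (fun x => f x * g x) - right_sum f g n| <=
  (v 1 - v 0) / Num.sqrt n%:R.
Proof.
move=> fv g2 g1 n0; have nR : (0 : R) < n%:R by rewrite ltr0n.
have f2 := majorized_L2_01 fv.
have gi := L2_01_integrable g2; have fgi := L2_01_integrable_mul f2 g2.
have grid i : (i < n)%N ->
    [/\ 0 <= i%:R / n%:R :> R, i%:R / n%:R < i.+1%:R / n%:R :> R &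
        i.+1%:R / n%:R <= 1 :> R].
  move=> ilt; split; first by rewrite divr_ge0.
    by rewrite ltr_pM2r ?invr_gt0// ltr_nat.
  by rewrite ler_pdivrMr// mul1r ler_nat.
have -> : integral01 (fun x => f x * g x) = \sum_(0 <= i < n)
    (Rintegral (@lebesgue_measure R) `[0, i.+1%:R / n%:R] (fun x => f x * g x) -
     Rintegral (@lebesgue_measure R) `[0, i%:R / n%:R] (fun x => f x * g x)).
  rewrite (telescope_sumr (fun i => Rintegral (@lebesgue_measure R)
    `[0, i%:R / n%:R] (fun x => f x * g x)))//.
  by rewrite mul0r divff ?gt_eqF// set_itv1 Rintegral_set1 subr0.
rewrite /right_sum -sumrB (le_trans (ler_norm_sum _ _ _))//.
apply: (@le_trans _ _ (\sum_(0 <= i < n)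
    (v (i.+1%:R / n%:R) - v (i%:R / n%:R)) / Num.sqrt n%:R)); last first.
  rewrite -mulr_suml (telescope_sumr (fun i => v (i%:R / n%:R)))//.
  by rewrite mul0r divff ?gt_eqF.
rewrite big_nat [leRHS]big_nat; apply: ler_sum => i /andP[_ ilt].
have [a0 ab b1] := grid i ilt.
have len : i.+1%:R / n%:R - i%:R / n%:R = n%:R^-1 :> R.
  by rewrite -mulrBl -natrB// subSnn mul1r.
have gJ := Rintegral_normr_le_sqrt g2 g1 a0 ab b1.
rewrite len sqrtrV ?ler0n// in gJ.
move: a0 ab b1 gJ; set a := i%:R / n%:R; set b := i.+1%:R / n%:R => a0 ab b1 gJ.
have mJ : measurable (`[a, b] : set (measurableTypeR R)) by [].
have giJ := integrable_itv_sub01 gi a0 b1.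
have fgiJ := integrable_itv_sub01 fgi a0 b1.
have cgiJ := integrable_scale (f b) mJ giJ.
have di := integrableB mJ fgiJ cgiJ.
have ngi : (@lebesgue_measure R).-integrable `[a, b] (EFin \o (fun x => `|g x|)).
  exact: integrable_norm.
have ab' := ltW ab.
rewrite !Rintegral_itv_diff// -RintegralZl// -RintegralB//.
rewrite (le_trans (le_normr_Rintegral _ _))//.
apply: (@le_trans _ _ (Rintegral (@lebesgue_measure R) `[a, b]
    (fun x => (v b - v a) * `|g x|))).
  apply: le_Rintegral => //.
  - exact: (integrable_norm di).
  - exact: integrable_scale.
  move=> x /=; rewrite in_itv/= => /andP[ax xb].
  rewrite -mulrBl normrM ler_wpM2r//.
  have := fv x b (le_trans a0 ax) xb b1; rewrite distrC => /le_trans; apply.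
  rewrite lerD2l lerN2 -subr_ge0.
  by rewrite (le_trans _ (fv a x a0 ax (le_trans xb b1))).
rewrite RintegralZl// ler_wpM2l//.
by rewrite (le_trans _ (fv a b a0 ab' b1)).
Qed.

(** * The divergence argument *)

Lemma right_sum_le_G (R : realType) (phi : nat -> R -> R) (d a : nat -> R)
    (f v : R -> R) (n : nat) : majorizes_variation v f -> (0 < n)%N ->
  `|right_sum f (P_ phi d a n) n| <=
  (`|f 1| + (v 1 - v 0)) * G_ phi d a n.
Proof.
move=> fv n0; have nR : (0 : R) < n%:R by rewrite ltr0n.
have G0 : 0 <= G_ phi d a n by exact: bigmax_ge_id.
apply: le_trans (@abel_summation_bound _ (fun i => f (i%:R / n%:R))
  (fun i => Rintegral (@lebesgue_measure R) `[0, i%:R / n%:R] (P_ phi d a n))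
  (G_ phi d a n) n _ _) _ => /=.
- by rewrite mul0r set_itv1 Rintegral_set1.
- case=> [_|i ilt]; first by rewrite mul0r set_itv1 Rintegral_set1 normr0.
  rewrite /G_.
  apply: (@le_bigmax_seq _ _ _ _ _ i.+1 xpredT
    (fun i => `|Rintegral lebesgue_measure `[0, i%:R / n%:R] (P_ phi d a n)|)) => //.
  by rewrite mem_index_iota.
- by rewrite divff ?gt_eqF// ler_wpM2r// lerD2l; exact: majorized_grid.
Qed.

(** Linearity of [right_sum] in its second argument, which reduces the error for
the polynomial to the errors for the single functions [phi k]. *)
Lemma right_sum_P (R : realType) (phi : nat -> R -> R) (d a : nat -> R)
    (f : R -> R) (n : nat) : orthonormal_system phi -> (0 < n)%N ->
  right_sum f (P_ phi d a n) n =
  \sum_(1 <= k < n.+1)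
    d k ^+ 2 * a k * log2 k%:R ^+ 2 * right_sum f (phi k) n.
Proof.
move=> [phi2 _] n0.
have Psum i : (i <= n)%N ->
    Rintegral (@lebesgue_measure R) `[0, i%:R / n%:R] (P_ phi d a n) =
    \sum_(1 <= k < n.+1) d k ^+ 2 * a k * log2 k%:R ^+ 2 *
      Rintegral (@lebesgue_measure R) `[0, i%:R / n%:R] (phi k).
  move=> ilt; have i1 : i%:R / n%:R <= 1 :> R.
    by rewrite ler_pdivrMr ?ltr0n// mul1r ler_nat.
  have phii k : (@lebesgue_measure R).-integrable `[0, i%:R / n%:R]
      (EFin \o phi k.+1).
    by apply: integrable_itv_sub01 => //; exact/L2_01_integrable/phi2.
  rewrite big_add1/=; under eq_Rintegral do rewrite /P_ big_add1/=.
  rewrite Rintegral_sum//; last by move=> k; exact: integrable_scale.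
  by apply: eq_bigr => k _; rewrite RintegralZl.
rewrite /right_sum; under [RHS]eq_bigr do rewrite mulr_sumr.
rewrite exchange_big/= big_nat [RHS]big_nat; apply: eq_bigr => i /andP[_ ilt].
rewrite !Psum ?(ltnW ilt)// -sumrB mulr_sumr.
by apply: eq_bigr => k _; ring.
Qed.

(** The left-hand side is the integral of [f * P_ phi d a n]. *)
Lemma fourier_pairing_le (R : realType) (phi : nat -> R -> R) (d a : nat -> R)
    (f v : R -> R) (n : nat) :
  orthonormal_system phi -> majorizes_variation v f -> (0 < n)%N ->
  \sum_(1 <= k < n.+1)
    d k ^+ 2 * a k * log2 k%:R ^+ 2 * fourier_coef phi f k <=
  (`|f 1| + (v 1 - v 0)) * G_ phi d a n +
  (v 1 - v 0) / Num.sqrt n%:R *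
    \sum_(1 <= k < n.+1) `|d k ^+ 2 * a k * log2 k%:R ^+ 2|.
Proof.
move=> ons fv n0; have [phi2 phi_orth] := ons.
apply: le_trans (lerD (le_trans (ler_norm _) (right_sum_le_G phi d a fv n0))
  (lexx _)).
rewrite right_sum_P// addrC -lerBlDr -sumrB mulr_sumr.
rewrite big_nat [leRHS]big_nat; apply: ler_sum => k /andP[k0 _].
rewrite -mulrBr (le_trans (ler_norm _))// normrM mulrC ler_wpM2r//.
apply: right_sum_error => //; first exact: phi2.
rewrite le_eqVlt; apply/orP; left; apply/eqP.
have := phi_orth k k k0 k0; rewrite eqxx; apply: etrans.
by rewrite /integral01; under eq_Rintegral do rewrite expr2.
Qed.

Theorem theorem2 (R : realType) (phi : nat -> R -> R) (d : nat -> R)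
    (phi_ons : orthonormal_system phi)
    (GOT : forall a : nat -> R, ell2 a ->
       (G_ phi d a : nat -> R^o) =O_\oo (T_ d a : nat -> R^o)) :
  forall f : R -> R, bounded_variation 0 1 f ->
    (\sum_(1 <= n <oo)
       (d n ^+ 2 * fourier_coef phi f n ^+ 2 * log2 n%:R ^+ 2)%:E < +oo)%E.
Proof.
move=> f /bounded_variation_majorant[v fv].
have f2 := majorized_L2_01 fv.
set C := fourier_coef phi f.
pose s k := d k ^+ 2 * C k ^+ 2 * log2 k%:R ^+ 2.
have s0 k : 0 <= s k by rewrite /s -!exprMn sqr_ge0.
have [[M sM]|unbounded] := pselect (exists M, forall n, \sum_(1 <= k < n.+1) s k <= M).
  exact: nneseries_lty s0 sM.
exfalso.
pose V := v 1 - v 0.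
have V0 : 0 <= V by rewrite (le_trans _ (fv 0 1 _ _ _)).
(* Beyond [h p], the replacement error of [f] against a polynomial with indices
   up to [p] and coefficients at most those of [C] is at most 1. *)
pose L p := \sum_(1 <= k < p.+1) `|d k ^+ 2 * C k * log2 k%:R ^+ 2|.
pose h p := (Num.truncn ((V * L p) ^+ 2)).+1.
have [M|A blocks] := sparse_blocks (s := s) h s0.
  apply: contrapT => nM; apply: unbounded; exists M => n.
  by rewrite leNgt; apply/negP => Mn; apply: nM; exists n.
pose a k := if A k then C k else 0.
have aell2 : ell2 a.
  apply: (@nneseries_lty _ _ (integral01 (fun x => f x ^+ 2))) => [k|n].
    exact: sqr_ge0.
  apply: le_trans (bessel n phi_ons f2); apply: ler_sum => k _.
  by rewrite /a; case: ifP => // _; rewrite expr0n sqr_ge0.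
have /eqO_exP[K K0 [N _ GK]] := GOT a aell2.
pose B := `|f 1| + V.
have B0 : 0 <= B by rewrite addr_ge0.
(* Beyond [N] the domination of [G_] by [T_] holds; the second bound exceeds
   what [T_ ^+ 2 <= B * K * T_ + 1] allows. *)
pose N' := maxn N (Num.truncn ((B * K + 1) ^+ 2)).+2.
have [p [m [N'm pm hm offA big]]] := blocks N'.
have m0 : (0 < m)%N by rewrite (leq_trans _ hm).
have Gm : G_ phi d a m <= K * T_ d a m.
  have := GK m; rewrite /= => /(_ (leq_trans (leq_maxl _ _) N'm)).
  have -> : `|T_ d a m : R^o| = T_ d a m by apply: ger0_norm; exact: sqrtr_ge0.
  by apply: le_trans; exact: ler_norm.
set S := \sum_(1 <= k < m.+1 | A k) s k in big.
have S_T : \sum_(1 <= k < m.+1) d k ^+ 2 * a k ^+ 2 * log2 k%:R ^+ 2 = S.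
  rewrite /S [RHS]big_mkcond/=; apply: eq_bigr => k _; rewrite /a.
  by case: ifP => // _; rewrite expr0n mulr0 mul0r.
have S_pair : \sum_(1 <= k < m.+1)
    d k ^+ 2 * a k * log2 k%:R ^+ 2 * C k = S.
  rewrite /S [RHS]big_mkcond/=; apply: eq_bigr => k _; rewrite /a.
  by case: ifP => // _; rewrite /s; ring.
have tail : \sum_(1 <= k < m.+1) `|d k ^+ 2 * a k * log2 k%:R ^+ 2| <= L p.
  rewrite (@big_cat_nat _ _ _ p.+1 1 m.+1)//= [X in _ + X]big1_seq ?addr0.
    apply: ler_sum => k _; rewrite /a; case: ifP => // _.
    by rewrite mulr0 mul0r normr0.
  move=> k; rewrite mem_index_iota => /and3P[_ pk km].
  by rewrite /a (negbTE (offA k _ _))// mulr0 mul0r normr0.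
have err : V / Num.sqrt m%:R *
    \sum_(1 <= k < m.+1) `|d k ^+ 2 * a k * log2 k%:R ^+ 2| <= 1.
  have sm : 0 < Num.sqrt (m%:R : R) by rewrite sqrtr_gt0 ltr0n.
  rewrite mulrAC ler_pdivrMr// mul1r.
  rewrite (le_trans (ler_wpM2l V0 tail))//.
  have VL : 0 <= V * L p by rewrite mulr_ge0// sumr_ge0.
  rewrite -(ger0_norm VL) -sqrtr_sqr ler_wsqrtr//.
  by rewrite (le_trans (ltW (truncnS_gt _)))// ler_nat.
have pair := fourier_pairing_le d a phi_ons fv m0.
rewrite [leLHS]S_pair in pair.
have T_S : T_ d a m = Num.sqrt S by rewrite /T_ S_T.
have S1 : 0 <= S by exact: sumr_ge0.
set t := Num.sqrt S in T_S.
have tS : t * t = S by rewrite -expr2 sqr_sqrtr.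
have t0 : 0 <= t by exact: sqrtr_ge0.
have bigS : (B * K + 1) ^+ 2 + 1 <= S.
  apply: le_trans big.
  apply: (@le_trans _ _ (Num.truncn ((B * K + 1) ^+ 2)).+2%:R); last first.
    by rewrite ler_nat leq_maxr.
  by rewrite -[leRHS]natr1 lerD2r ltW// truncnS_gt.
have S_le : S <= B * (K * t) + 1.
  rewrite (le_trans pair)// lerD//.
  by rewrite ler_wpM2l// -T_S.
have BK : 0 <= B * K by rewrite mulr_ge0// ltW.
have t1 : 1 <= t.
  by rewrite -sqrtr1 ler_wsqrtr// (le_trans _ bigS)// lerDr sqr_ge0.
have tBK : t <= B * K + 1.
  rewrite -(ler_pM2r (lt_le_trans ltr01 t1)) tS.
  apply: (le_trans S_le).
  by rewrite [leRHS]mulrDl mul1r -mulrA lerD2l.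
have : S <= (B * K + 1) ^+ 2 by rewrite -tS -expr2 lerXn2r// nnegrE addr_ge0.
by lra.
Qed.
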